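(* Let $\mu\in(0,1)$. Consider the regression model $Y_i=\mathbf 1(X_i\in G)+\xi_i$, $i=1,\dots,n$, with i.i.d. noise that is subgaussian with parameter $\sigma$ and independent of the design, and with design (DD) or (RD). The minimax risk on the class $\mathcal S(\mu)=\{[a,b]:0\le a\le b\le1,\ b-a\ge\mu\}$ satisfies, asymptotically, $$\mathcal R_n(\mathcal S(\mu))\asymp_{\mu,\sigma}\frac1n,$$ i.e. there exist positive constants $c(\mu,\sigma),C(\mu,\sigma)$ depending only on $\mu$ and $\sigma$ such that $c(\mu,\sigma)/n\le\mathcal R_n(\mathcal S(\mu))\le C(\mu,\sigma)/n$ for all $n$ large enough.
   Context: Model: one observes $(X_1,Y_1),\dots,(X_n,Y_n)$ with $Y_i=\mathbf 1(X_i\in G)+\xi_i$, where $G\subseteq[0,1]$ is an unknown segment. The noise variables $\xi_i$ are i.i.d., independent of the design, and satisfy $\mathbb E[e^{u\xi_i}]\le e^{\sigma^2u^2/2}$ for all $u\in\mathbb R$ ($\sigma>0$ constant). $\mathbb E_G$ is expectation when the segment is $G$. Designs: (DD) $X_i=i/n$, $i=1,\dots,n$; (RD) $X_1\le\dots\le X_n$ is the increasing reordering of $n$ i.i.d. uniform random variables on $[0,1]$. An estimator $\hat G_n$ is a (possibly empty) segment in $[0,1]$ constructed measurably from the $n$ observations. For a class $\mathcal C$ of segments, $\mathcal R_n(\hat G_n;\mathcal C)=\sup_{G\in\mathcal C}\mathbb E_G[|G\triangle\hat G_n|]$, where $|\cdot|$ is Lebesgue measure and $\triangle$ is symmetric difference;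 the minimax risk is $\mathcal R_n(\mathcal C)=\inf_{\tilde G_n}\mathcal R_n(\tilde G_n;\mathcal C)$, the infimum being over all estimators based on $n$ observations. *)

(* Defs.v *)
From HB Require Import structures.
From mathcomp Require Import all_boot all_order all_algebra.
From mathcomp Require Import all_classical all_reals all_analysis.

Set Implicit Arguments.
Unset Strict Implicit.
Unset Printing Implicit Defensive.

Import Order.TTheory GRing.Theory Num.Theory.
Import numFieldNormedType.Exports.

Local Open Scope classical_set_scope.
Local Open Scope ring_scope.

Section independence.
Context (R : realType) (d : measure_display) (T : measurableType d).
Variable P : probability T R.

Definition independent_pair d1 d2 (T1 : measurableType d1)
    (T2 : measurableType d2) (V : T -> T1) (W : T -> T2) : Prop :=
  forall (A : set T1) (B : set T2), measurable A -> measurable B ->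
    P (V @^-1` A `&` W @^-1` B) = (P (V @^-1` A) * P (W @^-1` B))%E.

(* Some of the [A i] may be [setT], so the product rule for every subfamily
   is included. *)
Definition mutually_independent n (Z : 'I_n -> T -> R) : Prop :=
  forall A : 'I_n -> set R, (forall i, measurable (A i)) ->
    P (\bigcap_(i in [set: 'I_n]) (Z i @^-1` A i)) =
    (\prod_(i < n) P (Z i @^-1` A i))%E.

Definition identically_distributed n (Z : 'I_n -> T -> R) : Prop :=
  forall (i j : 'I_n) (A : set R), measurable A ->
    P (Z i @^-1` A) = P (Z j @^-1` A).

End independence.

Section model.
Context (R : realType) (d : measure_display) (T : measurableType d).
Variable P : probability T R.

Definition subgaussian (sigma : R) (Z : T -> R) : Prop :=
  forall u : R, ('M_P Z u <= (expR (sigma ^+ 2 * u ^+ 2 / 2))%:E)%E.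

Definition iid_subgaussian (sigma : R) n (xi : 'I_n -> {RV P >-> R}) : Prop :=
  [/\ mutually_independent P xi,
      identically_distributed P xi &
      forall i, subgaussian sigma (xi i)].

(* The index [i : 'I_n] starts at 0. *)
Definition deterministic_design n (X : 'I_n -> {RV P >-> R}) : Prop :=
  forall i w, X i w = i.+1%:R / n%:R.

Definition random_design n (X : 'I_n -> {RV P >-> R}) : Prop :=
  exists U : 'I_n -> {RV P >-> R},
    [/\ mutually_independent P U,
        forall i (A : set R), measurable A ->
          P (U i @^-1` A) = uniform_prob (@ltr01 R) A &
        forall w, [seq X i w | i : 'I_n] = sort <=%R [seq U i w | i : 'I_n]].

Definition noise_independent_of_design n (X xi : 'I_n -> {RV P >-> R}) : Prop :=
  independent_pair P (fun w => [tuple X i w | i < n])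
                     (fun w => [tuple xi i w | i < n]).

Definition observations n (X xi : 'I_n -> {RV P >-> R}) (G : set R) (w : T) :
    n.-tuple (R * R) :=
  [tuple (X i w, \1_G (X i w) + xi i w) | i < n].

End model.

Section minimax.
Context (R : realType).

Definition segments (mu : R) : set (set R) :=
  [set G | exists a b : R,
    [/\ 0 <= a, a <= b, b <= 1, mu <= b - a & G = `[a, b]%classic]].

(* A measurable segment-valued map is encoded by its two endpoint maps; it
   takes the value [set0] at the points where [est_hi] is below [est_lo]. *)
Record estimator (n : nat) := Estimator {
  est_lo : {mfun n.-tuple (R * R) >-> R};
  est_hi : {mfun n.-tuple (R * R) >-> R};
  est_lo_ge0 : forall z, 0 <= est_lo z;
  est_hi_le1 : forall z, est_hi z <= 1 }.

Definition est_segment n (Gh : estimator n) (z : n.-tuple (R * R)) : set R :=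
  `[est_lo Gh z, est_hi Gh z]%classic.

Context (d : measure_display) (T : measurableType d) (P : probability T R).
Variables (n : nat) (X xi : 'I_n -> {RV P >-> R}).

Definition risk_at (Gh : estimator n) (G : set R) : \bar R :=
  (\int[P]_w lebesgue_measure (G `+` est_segment Gh (observations X xi G w)))%E.

Definition risk (Gh : estimator n) (C : set (set R)) : \bar R :=
  ereal_sup [set risk_at Gh G | G in C].

Definition minimax_risk (C : set (set R)) : \bar R :=
  ereal_inf [set risk Gh C | Gh in [set: estimator n]].

End minimax.

(* Main.v *)
(** The lower bound is a two-point argument: [[0, 1 - 1/n]] and
    [[0, 1 - 1/(2n)]] produce the same observations when no design point falls
    between their right endpoints, which has probability at least 1/2 under
    either design.

    For the upper bound, let the estimator maximise the contrast
    [sum_i (2 Y_i - 1) 1(X_i in A)] over the segments [A = [p/n, q/n]], and let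
    [B = [p0/n, q0/n]] be the rounding of [G] to the grid.  If [A] is selected,
    its contrast is at least that of [B]; so, summing over all [A], the loss is
    at most [sum_A (D_A + 2)/n * exp(u (contrast A - contrast B))], where
    [D_A = |p - p0| + |q - q0|].  Integrating the noise out first, by
    subgaussianity, leaves a product over the design points of a factor
    [exp(-kappa)] on [A symdiff B], of a bounded factor on the two grid
    cells where [G] and [B] may differ, and of 1 elsewhere.  Since
    [|G| >= mu], [A symdiff B] contains an interval of length at least
    [mu D_A / (4n)], so the expectation is [O(exp(-c D_A))] for both designs and
    the sum over [A] is a product of two geometric series. *)

Require Import Defs.
From HB Require Import structures.
From mathcomp Require Import all_boot all_order all_algebra.
From mathcomp Require Import all_classical all_reals all_analysis.
From mathcomp Require Import measurable_realfun.
From mathcomp Require Import zify ring lra.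

Set Implicit Arguments.
Unset Strict Implicit.
Unset Printing Implicit Defensive.

Import Order.TTheory GRing.Theory Num.Theory.
Import numFieldNormedType.Exports.

Local Open Scope classical_set_scope.
Local Open Scope ring_scope.

(** * Integrals under independence *)

Import HBNNSimple.

Section independence_integral.
Context (R : realType) (d : measure_display) (T : measurableType d).
Variable P : probability T R.

Lemma ge0_integral_nnsfun_comp d' (T' : measurableType d') (W : T -> T')
    (F : T -> R) (h : {nnsfun T' >-> R}) :
    measurable_fun setT W -> measurable_fun setT F -> (forall w, 0 <= F w) ->
  (\int[P]_w (F w * h (W w))%:E =
   \sum_(v \in range h) v%:E * \int[P]_w (F w * \1_(h @^-1` [set v]) (W w))%:E)%E.
Proof.
move=> mW mF F0.
have mI v : measurable_fun [set: T] (fun w => \1_(h @^-1` [set v]) (W w) : R).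
  by apply: measurableT_comp => //; apply: measurable_indic; exact: measurable_sfunP.
transitivity (\int[P]_w (\sum_(v \in range h)
    (v * (F w * \1_(h @^-1` [set v]) (W w)))%:E))%E.
  apply: eq_integral => w _; rewrite (fimfunE h (W w)) fsumEFin//; congr EFin.
  rewrite !fsbig_finite//= big_distrr/=.
  by apply: eq_bigr => v _; rewrite mulrCA.
rewrite ge0_integral_fsum//=.
- apply: eq_fsbigr => v /[!inE] -[y _ <-].
  rewrite -ge0_integralZl//=.
  + by apply/measurable_EFinP/measurable_funM.
  + by move=> w _; rewrite lee_fin mulr_ge0.
  + by rewrite lee_fin.
- by move=> v; apply/measurable_EFinP/measurable_funM => //; exact: measurable_funM.
(* Here [v] is any real, possibly negative; where the indicator is nonzero, however, [v] is a value
   of [h]. *)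
- move=> v w _; rewrite lee_fin indicE.
  case: (boolP (_ \in _)) => [/[!inE] <-|_]; last by rewrite !mulr0.
  by rewrite !mulr_ge0.
Qed.

(** Monotone convergence along simple approximations of [g]. With [F2] constant, this passes from
    independence tested on events to the factorisation of an integral. *)
Lemma ge0_integral_indic_ext d' (T' : measurableType d') (W : T -> T')
    (F1 F2 : T -> R) (g : T' -> R) :
    measurable_fun setT W ->
    measurable_fun setT F1 -> measurable_fun setT F2 ->
    (forall w, 0 <= F1 w) -> (forall w, 0 <= F2 w) ->
    (forall A, measurable A ->
      \int[P]_w (F1 w * \1_A (W w))%:E = \int[P]_w (F2 w * \1_A (W w))%:E)%E ->
    measurable_fun setT g -> (forall y, 0 <= g y) ->
  (\int[P]_w (F1 w * g (W w))%:E = \int[P]_w (F2 w * g (W w))%:E)%E.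
Proof.
move=> mW mF1 mF2 F10 F20 F12 mg g0.
have mg' : measurable_fun setT (EFin \o g) by exact/measurable_EFinP.
pose h := nnsfun_approx measurableT mg'.
have approx_lim (F : T -> R) : measurable_fun setT F -> (forall w, 0 <= F w) ->
    (\int[P]_w (F w * g (W w))%:E =
     limn (fun n => \int[P]_w (F w * h n (W w))%:E))%E.
  move=> mF F0; rewrite -monotone_convergence//.
  - apply: eq_integral => w _; apply/esym/cvg_lim => //.
    under eq_fun do rewrite EFinM.
    rewrite EFinM; apply: cvgeZl => //.
    apply: cvg_nnsfun_approx => //= y _; by rewrite lee_fin.
  - by move=> n; apply/measurable_EFinP/measurable_funM => //; exact: measurableT_comp.
  - by move=> n w _; rewrite lee_fin mulr_ge0.
  - move=> w _ m n mn; rewrite lee_fin ler_wpM2l//.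
    exact/lefP/nd_nnsfun_approx.
rewrite !approx_lim//; congr (limn _); apply/funext => n.
rewrite !ge0_integral_nnsfun_comp//; apply: eq_fsbigr => v _.
by rewrite F12//; exact: measurable_sfunP.
Qed.

Lemma mutually_independent_integral_prod n (Z : 'I_n -> {RV P >-> R})
    (g : 'I_n -> R -> R) (c : 'I_n -> R) :
    mutually_independent P Z ->
    (forall i, measurable_fun setT (g i)) -> (forall i x, 0 <= g i x) ->
    (forall i, \int[P]_w (g i (Z i w))%:E = (c i)%:E)%E ->
  (\int[P]_w (\prod_(i < n) g i (Z i w))%:E = (\prod_(i < n) c i)%:E)%E.
Proof.
move=> indZ mg g0 cE.
have c0 i : 0 <= c i by rewrite -lee_fin -cE integral_ge0// => w _; rewrite lee_fin.
(* Indicators are replaced by the functions [g i] one coordinate at a time. *)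
suff key k (A : 'I_n -> set R) : (forall i, measurable (A i)) -> (k <= n)%N ->
    (\int[P]_w (\prod_(i < n) (if (i < k)%N then g i (Z i w) else \1_(A i) (Z i w)))%:E
     = (\prod_(i < n) if (i < k)%N then c i else fine (P (Z i @^-1` A i)))%:E)%E.
  have := key n (fun=> setT) (fun=> measurableT) (leqnn n).
  under [in RHS]eq_bigr do rewrite ltn_ord.
  by under eq_integral do under eq_bigr do rewrite ltn_ord.
elim: k A => [|k IH] A mA kn.
  transitivity (\int[P]_w (\1_(\bigcap_(i in [set: 'I_n]) (Z i @^-1` A i)) w)%:E)%E.
    apply: eq_integral => w _; congr EFin; rewrite indicE.
    have [|] := boolP (_ \in _); rewrite ?inE/= => H.
      by rewrite big1// => i _; rewrite indicE mem_set//; exact: H.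
    have [i Hi] : exists i, ~ A i (Z i w).
      by apply/existsNP => H'; move/negP: H; apply; rewrite inE => i _; exact: H'.
    by rewrite (bigD1 i)//= indicE memNset// mul0r.
  rewrite integral_indic//; last first.
    by apply: fin_bigcap_measurable => // i _; exact: measurable_funPTI.
  rewrite setIT.
  transitivity (\prod_(i < n) P (Z i @^-1` A i))%E; first exact: indZ.
  rewrite -prodEFin; apply: eq_bigr => i _.
  by rewrite fineK// fin_num_measure//; exact: measurable_funPTI.
pose k' := Ordinal kn.
pose F w := \prod_(i < n | i != k')
   (if (i < k)%N then g i (Z i w) else \1_(A i) (Z i w)).
pose cF := \prod_(i < n | i != k')
   (if (i < k)%N then c i else fine (P (Z i @^-1` A i))).
have mF : measurable_fun setT F.
  rewrite (_ : F = fun w => \prod_(i <- [seq i <- index_enum 'I_n | i != k'])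
    (if (i < k)%N then g i (Z i w) else \1_(A i) (Z i w))); last first.
    by apply/funext => w; rewrite big_filter.
  apply: measurable_prod => i _; case: (i < k)%N.
    exact: measurableT_comp.
  by apply: measurableT_comp => //; exact: measurable_indic.
have F0 w : 0 <= F w.
  by apply: prodr_ge0 => i _; case: ifP => // _; rewrite indicE.
have cF0 : 0 <= cF.
  by apply: prodr_ge0 => i _; case: ifP => // _; rewrite fine_ge0.
have ltk (i : 'I_n) : i != k' -> (i < k.+1)%N = (i < k)%N.
  by move=> ik; rewrite ltnS leq_eqVlt -[(i == k :> nat)]/(i == k') (negbTE ik).
rewrite [RHS](_ : _ = (cF * c k')%:E); last first.
  rewrite (bigD1 k')//= ltnSn mulrC; congr (_ * _)%:E.
  by apply: eq_bigr => i ik; rewrite ltk.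
transitivity (\int[P]_w (F w * g k' (Z k' w))%:E)%E.
  apply: eq_integral => w _; rewrite (bigD1 k')//= ltnSn mulrC; congr (_ * _)%:E.
  by apply: eq_bigr => i ik; rewrite ltk.
rewrite (@ge0_integral_indic_ext _ _ (Z k') F (fun=> cF))//.
- under eq_integral do rewrite EFinM.
  rewrite ge0_integralZl//=; first by rewrite cE EFinM.
  + by apply/measurable_EFinP; exact: measurableT_comp.
  + by move=> w _; rewrite lee_fin.
(* The induction hypothesis is taken with [B] as the set of index [k'], which is why the induction
   quantifies over [A]: [F] and the constant [cF] have the same integral over every event that
   [Z k'] lies in [B]. *)
- move=> B mB.
  have mA' i : measurable (if i == k' then B else A i) by case: ifP.
  have := IH _ mA' (ltnW kn).
  under eq_integral => w _.
    rewrite (bigD1 k')//= ltnn eqxx mulrC.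
    rewrite (_ : \prod_(i < n | i != k') _ = F w); last first.
      by apply: eq_bigr => i ik; rewrite (negbTE ik).
    over.
  move=> ->; rewrite (bigD1 k')//= ltnn eqxx mulrC.
  rewrite (_ : \prod_(i < n | i != k') _ = cF); last first.
    by apply: eq_bigr => i ik; rewrite (negbTE ik).
  under [RHS]eq_integral do rewrite EFinM.
  have mZB : measurable (Z k' @^-1` B) by exact: measurable_funPTI.
  rewrite ge0_integralZl//=; last first.
    by apply/measurable_EFinP; apply: measurableT_comp => //; exact: measurable_indic.
  rewrite EFinM fineK ?fin_num_measure//; congr *%E.
  rewrite -[RHS]/(\int[P]_w (\1_(Z k' @^-1` B) w)%:E)%E.
  by rewrite integral_indic// setIT.
Qed.

(** By uniqueness of product measures the joint law of [V] and [W] is the product of the marginals;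
    Tonelli does the rest. *)
Lemma independent_pair_integral d1 d2 (T1 : measurableType d1)
    (T2 : measurableType d2) (V : {mfun T >-> T1}) (W : {mfun T >-> T2})
    (f : T1 * T2 -> \bar R) :
    independent_pair P V W -> measurable_fun setT f -> (forall z, 0 <= f z)%E ->
  (\int[P]_w f (V w, W w) = \int[P]_w \int[P]_w' f (V w, W w'))%E.
Proof.
move=> indVW mf f0.
have mVW : measurable_fun setT (fun w => (V w, W w)) by exact: measurable_fun_pair.
pose VW : {mfun T >-> (T1 * T2)%type} := mfun_Sub (mem_set mVW).
transitivity (\int[distribution P VW]_z f z)%E.
  by rewrite ge0_integral_distribution.
rewrite (@eq_measure_integral _ _ _ _ (distribution P V \x distribution P W)%E); last first.
  move=> A mA _; apply/esym; apply: product_measure_unique => //.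
rewrite fubini_tonelli1// /fubini_F.
rewrite ge0_integral_distribution//=; last 2 first.
- exact: measurable_fun_fubini_tonelli_F.
- by move=> x; apply: integral_ge0.
apply: eq_integral => w _ /=; rewrite ge0_integral_distribution//.
exact: measurableT_comp.
Qed.

Lemma measurable_integral_comp_pair d1 d2 (T1 : measurableType d1)
    (T2 : measurableType d2) (V : {mfun T >-> T1}) (W : {mfun T >-> T2})
    (f : T1 * T2 -> \bar R) :
    measurable_fun setT f -> (forall z, 0 <= f z)%E ->
  measurable_fun setT (fun w => \int[P]_w' f (V w, W w'))%E.
Proof.
move=> mf f0.
have mF : measurable_fun setT (fubini_F (distribution P W) f).
  exact: measurable_fun_fubini_tonelli_F.
have := measurableT_comp mF (@measurable_funPT _ _ _ _ V).
apply: eq_measurable_fun => w _ /=.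
rewrite /fubini_F ge0_integral_distribution//.
exact: measurableT_comp.
Qed.

End independence_integral.

(** * Lower bound *)

Section loss_measurability.
Context (R : realType).

(** The loss at [z] is the Lebesgue measure of the section at [z] of a measurable subset of the
    product space. *)
Lemma measurable_est_loss n (Gh : estimator R n) (G : set R) : measurable G ->
  measurable_fun setT
    (fun z => lebesgue_measure (G `+` est_segment Gh z) : \bar R).
Proof.
move=> mG.
pose S : set (n.-tuple (R * R) * R) :=
  [set zx | est_lo Gh zx.1 <= zx.2] `&` [set zx | zx.2 <= est_hi Gh zx.1].
have mS : measurable S.
  apply: measurableI.
  - rewrite -[X in measurable X]setTI; apply: measurable_fun_le => //.
    exact: measurableT_comp.
  - rewrite -[X in measurable X]setTI; apply: measurable_fun_le => //.
    exact: measurableT_comp.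
have mA : measurable ((setT `*` G) `+` S).
  have mTG : measurable ([set: n.-tuple (R * R)] `*` G) by exact: measurableX.
  by apply: measurableU; apply: measurableD.
have := measurable_fun_xsection lebesgue_measure mA.
apply: eq_measurable_fun => z _ /=; congr (lebesgue_measure _).
rewrite /xsection /est_segment set_itvcc; apply/seteqP.
split=> x; rewrite /S /= inE /=.
- by move=> [[[_ ?] H]|[[-> ->] H]]; [left|right]; split=> //;
    [apply: contra_not H => /andP|move=> ?; apply: H].
- by move=> [[? H]|[/andP[? ?] H]]; [left|right]; split=> //;
    [move=> [? ?]; apply: H; exact/andP|case].
Qed.

Context (d : measure_display) (T : measurableType d) (P : probability T R).

Lemma measurable_observations n (X xi : 'I_n -> {RV P >-> R}) (G : set R) :
  measurable G -> measurable_fun setT (observations X xi G).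
Proof.
move=> mG; apply/measurable_fun_tnthP => i.
rewrite [X in measurable_fun _ X](_ : _ =
    fun w => (X i w, \1_G (X i w) + xi i w)); last first.
  by apply/funext => w; rewrite /= tnth_mktuple.
apply: measurable_fun_pair => //; apply: measurable_funD => //.
by apply: measurableT_comp => //; exact: measurable_indic.
Qed.

Lemma measurable_loss n (X xi : 'I_n -> {RV P >-> R}) (Gh : estimator R n)
    (G : set R) : measurable G ->
  measurable_fun setT
    (fun w => lebesgue_measure (G `+` est_segment Gh (observations X xi G w))
      : \bar R).
Proof.
move=> mG; apply: (measurableT_comp (measurable_est_loss Gh mG)).
exact: measurable_observations.
Qed.

Lemma measurable_est_segment n (Gh : estimator R n) z :
  measurable (est_segment Gh z).
Proof. exact: measurable_itv. Qed.

(** On [E] both segments give the same data, hence the same estimate [S], and the symmetric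
    difference of [G1] and [G2] is covered by those of each with [S]. The two risks thus add up to
    at least [2 * r] and cannot both be below [r]. *)
Lemma two_point_lower_bound n (X xi : 'I_n -> {RV P >-> R}) (C : set (set R))
    (G1 G2 : set R) (E : set T) (r : R) :
    measurable G1 -> measurable G2 -> measurable E -> C G1 -> C G2 ->
    (forall w i, E w -> \1_G1 (X i w) = \1_G2 (X i w) :> R) ->
    ((2 * r)%:E <= lebesgue_measure (G1 `+` G2) * P E)%E ->
  (r%:E <= minimax_risk X xi C)%E.
Proof.
move=> mG1 mG2 mE CG1 CG2 eqG hr.
apply: le_ereal_inf_tmp => _ [Gh _ <-]; rewrite leNgt; apply/negP => risk_lt.
have lt1 : (risk_at X xi Gh G1 < r%:E)%E.
  by apply: le_lt_trans risk_lt; apply: ereal_sup_ubound; exists G1.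
have lt2 : (risk_at X xi Gh G2 < r%:E)%E.
  by apply: le_lt_trans risk_lt; apply: ereal_sup_ubound; exists G2.
have := lteD lt1 lt2; rewrite -EFinD -mulr2n -mulr_natl ltNge => /negP; apply.
apply: (le_trans hr).
rewrite /risk_at -ge0_integralD//; last 2 first.
- exact: measurable_loss.
- exact: measurable_loss.
apply: (@le_trans _ _ (\int[P]_w (lebesgue_measure (G1 `+` G2) * (\1_E w)%:E))%E).
  rewrite ge0_integralZl//; first by rewrite integral_indic// setIT.
  by apply/measurable_EFinP; exact: measurable_indic.
apply: ge0_le_integral => //.
- by move=> w _; rewrite mule_ge0// lee_fin.
- by apply: emeasurable_funM => //; apply/measurable_EFinP; exact: measurable_indic.
- by apply: emeasurable_funD; exact: measurable_loss.
- move=> w _; rewrite indicE; have [/[!inE] Ew|] := boolP (w \in E); last first.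
    by rewrite mule0 adde_ge0.
  rewrite mule1.
  have -> : observations X xi G2 w = observations X xi G1 w.
    by apply: eq_from_tnth => i; rewrite !tnth_mktuple eqG.
  set S := est_segment _ _.
  have mS : measurable S by exact: measurable_est_segment.
  have mY A B : measurable A -> measurable B -> measurable (A `+` B : set R).
    by move=> mA mB; apply: measurableU; apply: measurableD.
  apply: (@le_trans _ _ (lebesgue_measure ((G1 `+` S) `|` (G2 `+` S)))); last first.
    by apply: measureU2; exact: mY.
  apply: le_measure; rewrite ?inE; [exact: mY|by apply: measurableU; exact: mY|].
  move=> x [] [h1 h2].
  + by have [Sx|Sx] := pselect (S x); [right; right|left; left].
  + by have [Sx|Sx] := pselect (S x); [left; right|right; left].
Qed.

End loss_measurability.

(** * Intervals avoided by the design *)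

Section uniform_design.
Context (R : realType).

Lemma uniform_prob01E (A : set R) : measurable A ->
  uniform_prob (@ltr01 R) A = lebesgue_measure (A `&` `[0, 1]).
Proof.
move=> mA; rewrite /uniform_prob integral_uniform_pdf.
transitivity (\int[lebesgue_measure]_(x in A `&` `[0%R, 1%R]) 1%:E)%E.
  apply: eq_integral => x /[!inE] -[_] /=; rewrite in_itv/= /uniform_pdf => ->.
  by rewrite subr0 invr1.
rewrite integral_cst ?mul1e//; exact: measurableI.
Qed.

Lemma bernoulli_le (x : R) n : 0 <= x <= 1 -> 1 - n%:R * x <= (1 - x) ^+ n.
Proof.
move=> /andP[x0 x1]; elim: n => [|n IH]; first by rewrite mul0r subr0 expr0.
rewrite exprSr -subr_ge0 in IH *.
have y0 : 0 <= 1 - x by rewrite subr_ge0.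
have n0 : 0 <= n%:R :> R by rewrite ler0n.
have := mulr_ge0 IH y0; rewrite -natr1; nra.
Qed.

Context (d : measure_display) (T : measurableType d) (P : probability T R).

(** Sorting does not change the set of design points, so [E] is defined through the independent
    [U i]; its probability is [(1 - (t - s)) ^+ n], to which Bernoulli's inequality applies. *)
Lemma random_design_avoid n (X : 'I_n -> {RV P >-> R}) (s t : R) :
    0 <= s -> s < t -> t <= 1 -> random_design X ->
  exists E, [/\ measurable E, ((1 - n%:R * (t - s))%:E <= P E)%E &
    forall w i, E w -> ~ `]s, t]%classic (X i w)].
Proof.
move=> s0 st t1 [U [indU unifU sortU]].
exists (\bigcap_(i in [set: 'I_n]) (U i @^-1` ~` `]s, t])); split.
- by apply: fin_bigcap_measurable => // i _; apply: measurable_funPTI => //;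
    exact: measurableC.
- rewrite (indU (fun=> ~` `]s, t]%classic)); last first.
    by move=> i; exact: measurableC.
  rewrite (eq_bigr (fun=> (1 - (t - s))%:E)); last first.
    move=> i _; rewrite unifU; last exact: measurableC.
    rewrite probability_setC// [X in (1 - X)%E](_ : _ = (t - s)%:E)//.
    transitivity (uniform_prob (@ltr01 R) `]s, t]%classic) => //.
    rewrite uniform_prob01E// setIidl; last first.
      move=> x /=; rewrite !in_itv/= => /andP[sx xt].
      by rewrite (ltW (le_lt_trans s0 sx)) (le_trans xt).
    by rewrite lebesgue_measure_itv/= lte_fin st -EFinD.
  rewrite prodEFin prodr_const card_ord lee_fin bernoulli_le//.
  by apply/andP; split; lra.
- move=> w i Ew.
  have : X i w \in [seq X i w | i : 'I_n] by apply: map_f; rewrite mem_enum.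
  by rewrite sortU mem_sort => /mapP[j _ ->]; exact: (Ew j).
Qed.

Lemma design_avoid n (X : 'I_n -> {RV P >-> R}) : (0 < n)%N ->
    deterministic_design X \/ random_design X ->
  exists E, [/\ measurable E, (2^-1%:E <= P E)%E &
    forall w i, E w -> ~ `]1 - n%:R^-1, 1 - (2 * n%:R)^-1]%classic (X i w)].
Proof.
move=> n0.
have n1 : 1 <= n%:R :> R by rewrite ler1n.
have nV0 : 0 < n%:R^-1 :> R by rewrite invr_gt0; lra.
have nV1 : n%:R^-1 <= 1 :> R by rewrite invf_le1; lra.
have nVE : n%:R * n%:R^-1 = 1 :> R by rewrite divff// gt_eqF; lra.
rewrite invfM; case=> [detX|].
- exists setT; split=> //; first by rewrite probability_setT lee_fin; lra.
  move=> w i _ /=; rewrite detX in_itv/= => /andP[h1 h2].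
  (* A design point in the interval would put the integer [i.+1] strictly between [n - 1] and
     [n]. *)
  have : n%:R - 1 < i.+1%:R :> R.
    by rewrite -(@ltr_pM2r _ n%:R^-1)// mulrBl nVE mul1r.
  have : i.+1%:R < n%:R :> R.
    by rewrite -(@ltr_pM2r _ n%:R^-1)// nVE; lra.
  by rewrite ltrBlDr natr1 !ltr_nat; lia.
- move=> /random_design_avoid => /(_ (1 - n%:R^-1) (1 - 2^-1 * n%:R^-1)).
  case; [lra|lra|lra|].
  move=> E [mE hE avE]; exists E; split=> //.
  apply: le_trans hE; rewrite lee_fin.
  rewrite (_ : n%:R * _ = 2^-1 * (n%:R * n%:R^-1)); last lra.
  by rewrite nVE; lra.
Qed.

Lemma minimax_lower_bound n (mu : R) (X xi : 'I_n -> {RV P >-> R}) :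
    (0 < n)%N -> mu <= 1 - n%:R^-1 ->
    deterministic_design X \/ random_design X ->
  ((8^-1 / n%:R)%:E <= minimax_risk X xi (segments mu))%E.
Proof.
move=> n0 hmu design.
have n1 : 1 <= n%:R :> R by rewrite ler1n.
have nV0 : 0 < n%:R^-1 :> R by rewrite invr_gt0; lra.
have nV1 : n%:R^-1 <= 1 :> R by rewrite invf_le1; lra.
have [E [mE hE avE]] := design_avoid n0 design.
have half : (2 * n%:R)^-1 = 2^-1 * n%:R^-1 :> R by rewrite invfM.
rewrite half in avE.
apply: (@two_point_lower_bound _ _ _ _ n X xi _ `[0, 1 - n%:R^-1]%classic
  `[0, 1 - 2^-1 * n%:R^-1]%classic E) => //.
- by exists 0, (1 - n%:R^-1); split=> //; lra.
- by exists 0, (1 - 2^-1 * n%:R^-1); split=> //; lra.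
- move=> w i /(avE w i) /=; rewrite in_itv/= => /negP av.
  rewrite !indicE; congr (_%:R); congr nat_of_bool.
  apply/idP/idP; rewrite !inE/= !in_itv/= => /andP[-> h] //=.
    lra.
  by rewrite leNgt; apply: contra av => ->.
(* The segments differ by a length [1 / (2 n)] and [E] has probability at least [1 / 2]; the product
   [1 / (4 n)] is twice [8^-1 / n]. *)
- apply: (@le_trans _ _ ((2^-1 * n%:R^-1)%:E * 2^-1%:E)%E).
    by rewrite -EFinM lee_fin; lra.
  apply: lee_pmul => //; rewrite ?lee_fin.
  apply: (@le_trans _ _ (lebesgue_measure `]1 - n%:R^-1, 1 - 2^-1 * n%:R^-1]%classic)).
    rewrite lebesgue_measure_itv/= lte_fin ifT; last lra.
    by rewrite -EFinD lee_fin; lra.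
  apply: le_measure; rewrite ?inE//.
    by apply: measurableU; apply: measurableD.
  rewrite set_itvoc !set_itvcc => x /= /andP[h1 h2]; right; split; first lra.
  by move=> /andP[_]; rewrite leNgt h1.
Qed.

End uniform_design.

(** * The grid estimator *)

Section grid_estimator.
Context (R : realType).

(** The maximiser is built along a list of indices, its level sets staying measurable at each
    comparison. *)
Lemma measurable_argmax (K : finType) (k0 : K) d (Z : measurableType d)
    (A : K -> Z -> R) : (forall k, measurable_fun setT (A k)) ->
  exists m : Z -> K, (forall z k, A k z <= A (m z) z) /\
    (forall k, measurable [set z | m z = k]).
Proof.
move=> mA.
suff key (s : seq K) : exists m : Z -> K,
    (forall z k, k \in s -> A k z <= A (m z) z) /\
    (forall k, measurable [set z | m z = k]).
  have [m [hm mm]] := key (enum K).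
  by exists m; split=> // z k; apply: hm; rewrite mem_enum.
elim: s => [|x s [m [hm mm]]].
  exists (fun=> k0); split=> // k.
  have [->|k0k] := eqVneq k0 k.
    by rewrite (_ : [set _ | _] = setT)//; apply/seteqP.
  rewrite (_ : [set _ | _] = set0)//; apply/seteqP; split=> // z /= /eqP.
  by rewrite (negbTE k0k).
pose D := [set z | A x z <= A (m z) z].
have mD : measurable D.
  (* Fixing the value of [m z] reduces to comparing two given measurable functions. *)
  rewrite (_ : D = \bigcup_(j in [set: K])
      ([set z | m z = j] `&` [set z | A x z <= A j z])); last first.
    by apply/seteqP; split=> z; [exists (m z)|move=> [j _] /= [<-]].
  apply: fin_bigcup_measurable => [|j _]; first exact: finite_finset.
  by apply: measurable_fun_le => //; apply: measurable_funTS.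
exists (fun z => if A x z <= A (m z) z then m z else x); split.
- move=> z k; rewrite inE => /predU1P[->|ks].
    by case: ifPn => //; rewrite lexx.
  case: ifPn => [_|]; first exact: hm.
  by rewrite -ltNge => /ltW; apply: le_trans; exact: hm.
- move=> k; rewrite (_ : [set _ | _] =
      (D `&` [set z | m z = k]) `|` (~` D `&` [set z | x = k])); last first.
    apply/seteqP; split=> z /=; rewrite /D/=.
      by case: ifPn => h <-; [left|right; split=> //; exact/negP].
    by case=> -[h] <-; rewrite ?h//; move/negP/negbTE: h => ->.
  apply: measurableU; first exact: measurableI.
  apply: measurableI; first exact: measurableC.
  have [->|xk] := eqVneq x k.
    by rewrite (_ : [set _ | _] = setT)//; apply/seteqP.
  rewrite (_ : [set _ | _] = set0)//; apply/seteqP; split=> // z /= /eqP.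
  by rewrite (negbTE xk).
Qed.

Lemma measurable_fun_finite_factor (K : finType) d (Z : measurableType d)
    (m : Z -> K) (f : K -> R) : (forall k, measurable [set z | m z = k]) ->
  measurable_fun setT (f \o m).
Proof.
move=> mm.
rewrite (_ : f \o m = fun z => \sum_(k : K) f k * \1_[set z | m z = k] z).
  apply: measurable_sum => k; apply: measurable_funM => //.
apply/funext => z /=; rewrite (bigD1 (m z))//= indicE mem_set// mulr1 big1 ?addr0//.
by move=> k km; rewrite indicE memNset ?mulr0//= => /eqP; rewrite eq_sym (negbTE km).
Qed.

(** Since [(y - 1)^2 - y^2 = 1 - 2 y], maximising this over [A] amounts to least squares. *)
Definition contrast n (A : set R) (z : n.-tuple (R * R)) : R :=
  \sum_(i < n) (2 * (tnth z i).2 - 1) * \1_A (tnth z i).1.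

(** For positive [n], pairs with [k.2 < k.1] encode the empty segment, so the index set is a full
    product. *)
Definition grid_segment n (k : 'I_n.+1 * 'I_n.+1) : set R :=
  `[k.1%:R / n%:R, k.2%:R / n%:R]%classic.

Lemma measurable_contrast n (A : set R) :
  measurable A -> measurable_fun setT (@contrast n A).
Proof.
move=> mA; apply: measurable_sum => i.
have mi : measurable_fun [set: n.-tuple (R * R)] (fun z => tnth z i).
  exact: measurable_tnth.
apply: measurable_funM.
  apply: measurable_funB => //; apply: measurable_funM => //.
  exact: (measurableT_comp measurable_snd).
apply: measurableT_comp; first exact: measurable_indic.
exact: (measurableT_comp measurable_fst).
Qed.

Lemma grid_estimator n : exists (Gh : estimator R n)
    (m : n.-tuple (R * R) -> 'I_n.+1 * 'I_n.+1),
  (forall z k, contrast (@grid_segment n k) z <= contrast (@grid_segment n (m z)) z) /\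
  (forall z, est_segment Gh z = @grid_segment n (m z)).
Proof.
have [m [hm mm]] := @measurable_argmax _ (ord0, ord0) _ _
  (fun k : 'I_n.+1 * 'I_n.+1 => @contrast n (grid_segment k))
  (fun k => measurable_contrast (measurable_itv _)).
have mlo := measurable_fun_finite_factor
  (fun k : 'I_n.+1 * 'I_n.+1 => k.1%:R / n%:R) mm.
have mhi := measurable_fun_finite_factor
  (fun k : 'I_n.+1 * 'I_n.+1 => k.2%:R / n%:R) mm.
pose lo : {mfun n.-tuple (R * R) >-> R} := mfun_Sub (mem_set mlo).
pose hi : {mfun n.-tuple (R * R) >-> R} := mfun_Sub (mem_set mhi).
have lo0 z : 0 <= lo z by rewrite /= divr_ge0.
have hi1 z : hi z <= 1.
  (* For [n = 0] the quotient is 0, since the inverse of 0 is 0 by convention. *)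
  rewrite /=; have [n0|n0] := leqP n 0%N.
    by rewrite (_ : n%:R = 0 :> R) ?invr0 ?mulr0//; case: n n0 {m hm mm mlo mhi lo hi lo0 z}.
  by rewrite ler_pdivrMr ?ltr0n// mul1r ler_nat -ltnS.
by exists (Estimator lo0 hi1), m.
Qed.

End grid_estimator.

(** * Upper bound *)

Section combinatorics.
Context (R : realType).

(** The exponent is [|p - p0|], written with truncated subtraction. Each side of [p0] carries a
    geometric series of sum at most [1 / (1 - r)]. *)
Lemma geometric_dist_sum (r : R) p0 N : 0 < r < 1 ->
  \sum_(p < N) r ^+ ((p - p0) + (p0 - p)) <= 2 / (1 - r).
Proof.
move=> /andP[r0 r1]; rewrite ler_pdivlMr; last lra.
(* To be inductive the bound follows the partial sums: it rises to 1 at [N = p0], then telescopes as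
   terms [r ^+ j * (1 - r)] are added. *)
suff : (\sum_(p < N) r ^+ ((p - p0) + (p0 - p))) * (1 - r) <=
    if (N <= p0)%N then r ^+ (p0 - N) else 2 - r ^+ (N - p0).
  move=> /le_trans; apply; case: ifP => _; last first.
    by have := exprn_ge0 (N - p0) (ltW r0); lra.
  have : r ^+ (p0 - N) <= 1 by rewrite exprn_ile1// ltW.
  lra.
elim: N => [|N IH].
  by rewrite big_ord0 mul0r subn0 leq0n exprn_ge0// ltW.
rewrite big_ord_recr/= mulrDl.
case: ltngtP IH => [Np|pN|->] IH.
- rewrite (_ : (N - p0 = 0)%N) ?add0n; last lia.
  rewrite -(subnSK Np) exprS in IH *.
  (* What is needed is [r * (2 - r) <= 1]. *)
  have := mulr_ge0 (exprn_ge0 (p0 - N.+1) (ltW r0)) (sqr_ge0 (1 - r)).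
  rewrite expr2; lra.
- rewrite (_ : (p0 - N = 0)%N) ?addn0; last lia.
  rewrite subSn ?exprS; last lia.
  lra.
- rewrite subnn expr0 subSnn expr1 in IH *; lra.
Qed.

(* The segments are allowed to be empty ([q < p]) or disjoint; the second
   alternative covers these cases. *)
Lemma exists_interval_symdiff (n p q p0 q0 : nat) :
    (p <= n)%N -> (q <= n)%N -> (p0 <= q0)%N -> (q0 <= n)%N ->
  exists s t : nat, [/\ (s <= t)%N, (t <= n)%N,
    (forall x : R, s%:R < x < t%:R ->
       (p%:R <= x <= q%:R) = ~~ (p0%:R <= x <= q0%:R)) &
    ((p - p0) + (p0 - p) + ((q - q0) + (q0 - q)) <= 2 * (t - s))%N \/
    (q0 - p0 <= t - s)%N].
Proof.
move=> pn qn pq0 q0n.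
have ler (i j : nat) : (i <= j)%N -> i%:R <= j%:R :> R by rewrite ler_nat.
(* In [inB] the interval []s, t[] lies inside [[p0, q0]] and off [[p, q]]; in [inA] the roles are
   exchanged. *)
have inB s t : (p0 <= s)%N -> (t <= q0)%N -> (q <= s)%N \/ (t <= p)%N ->
    forall x : R, s%:R < x < t%:R -> (p%:R <= x <= q%:R) = ~~ (p0%:R <= x <= q0%:R).
  move=> /ler h1 /ler h2 h3 x /andP[sx xt].
  rewrite (le_trans h1 (ltW sx)) (le_trans (ltW xt) h2)/=.
  case: h3 => /ler h3; apply/negbTE; rewrite negb_and -!ltNge.
    by rewrite (le_lt_trans h3 sx) orbT.
  by rewrite (lt_le_trans xt h3).
have inA s t : (p <= s)%N -> (t <= q)%N -> (q0 <= s)%N \/ (t <= p0)%N ->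
    forall x : R, s%:R < x < t%:R -> (p%:R <= x <= q%:R) = ~~ (p0%:R <= x <= q0%:R).
  move=> /ler h1 /ler h2 h3 x /andP[sx xt].
  rewrite (le_trans h1 (ltW sx)) (le_trans (ltW xt) h2)/=.
  case: h3 => /ler h3; apply/esym; rewrite negb_and -!ltNge.
    by rewrite (le_lt_trans h3 sx) orbT.
  by rewrite (lt_le_trans xt h3).
(* The endpoint that moved more accounts for at least half of the total, so the interval is taken
   between its two positions; if the segments do not meet, all of [[p0, q0]] is taken. *)
have [D|D] := leqP ((q - q0) + (q0 - q)) ((p - p0) + (p0 - p)).
- have [h|h|h] := ltngtP p p0.
  + have [h'|h'] := leqP p0 q.
      by exists p, p0; split; [lia|lia|apply: inA; lia|lia].
    by exists p0, q0; split; [lia|lia|apply: inB; lia|lia].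
  + by exists p0, (minn p q0); split; [lia|lia|apply: inB; lia|lia].
  (* Both displacements vanish, so an empty interval suffices. *)
  + by exists 0%N, 0%N; split => [//|//|x|]; [rewrite ltNge; case: leP; lra|lia].
- have [h|h|h] := ltngtP q q0.
  + by exists (maxn q p0), q0; split; [lia|lia|apply: inB; lia|lia].
  + have [h'|h'] := leqP p q0.
      by exists q0, q; split; [lia|lia|apply: inA; lia|lia].
    by exists p0, q0; split; [lia|lia|apply: inB; lia|lia].
  + lia.
Qed.

Lemma sum_grid_interior n s t : (t <= n)%N ->
  (\sum_(i < n) (s < i.+1 < t)%N = t - s.+1)%N.
Proof.
(* With [t] replaced by [minn n.+1 t] on the right, the identity holds for every [n] and can be
   proved by induction. *)
move=> tn; rewrite -[in RHS](minn_idPr (leqW tn)).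
elim: n {tn} => [|n IH]; first by rewrite big_ord0; lia.
rewrite big_ord_recr/= IH; case: (ltnP s n.+1); case: (ltnP n.+1 t); lia.
Qed.

Lemma sum_grid_cell n p : (\sum_(i < n) (p <= i.+1 < p.+1)%N <= 1)%N.
Proof.
(* The inequality alone is not inductive; the exact count is. *)
rewrite (_ : \sum_(i < n) _ = (0 < p <= n)%N :> nat); first exact: leq_b1.
elim: n => [|n IH]; first by rewrite big_ord0; lia.
rewrite big_ord_recr/= IH; lia.
Qed.

(** A point of exactly one segment lies between the two left endpoints or between the two right
    ones, even when a segment is empty. *)
Lemma symdiff_itv_measure_le (a b s t : R) :
  (lebesgue_measure (`[a, b] `+` `[s, t]) <= (`|a - s| + `|b - t|)%:E)%E.
Proof.
pose I (x y : R) := `[Num.min x y, Num.max x y]%classic.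
have II x y : lebesgue_measure (I x y) = `|x - y|%:E.
  rewrite lebesgue_measure_itv/= lte_fin -EFinD.
  have [xy|xy|->] := ltgtP x y.
  - by rewrite xy distrC gtr0_norm// subr_gt0.
  - by rewrite xy gtr0_norm// subr_gt0.
  - by rewrite ltxx subrr normr0.
rewrite EFinD -!II.
apply: (@le_trans _ _ (lebesgue_measure (I a s `|` I b t))); last first.
  by apply: measureU2; exact: measurable_itv.
apply: le_measure; rewrite ?inE.
- by apply: measurableU; apply: measurableD; exact: measurable_itv.
- by apply: measurableU; exact: measurable_itv.
rewrite /I !set_itvcc => x /= [] [/andP[h1 h2] /negP].
- rewrite negb_and -!ltNge => /orP[h|h]; [left|right]; rewrite ge_min le_max.
    by rewrite h1 (ltW h) orbT.
  by rewrite h2 (ltW h) orbT.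
- rewrite negb_and -!ltNge => /orP[h|h]; [left|right]; rewrite ge_min le_max.
    by rewrite h1 (ltW h) orbT.
  by rewrite h2 (ltW h) orbT.
Qed.

End combinatorics.

(** * Integrating out the noise *)

Section moment_bound.
Context (R : realType) (d : measure_display) (T : measurableType d).
Variable P : probability T R.

(* The conditional moment generating function, given one design point [x], of
   its contribution to [contrast A - contrast B] at [2 kappa], once the noise
   has been replaced by its subgaussian bound. *)
Definition tilt (kappa : R) (G A B : set R) (x : R) : R :=
  expR (2 * kappa * ((\1_A x - \1_B x) * (2 * \1_G x - 1)) +
        kappa * (\1_A x - \1_B x) ^+ 2).

Lemma measurable_tilt kappa (G A B : set R) :
  measurable G -> measurable A -> measurable B ->
  measurable_fun setT (tilt kappa G A B).
Proof.
move=> mG mA mB.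
have mI (D : set R) : measurable D -> measurable_fun [set: R] (\1_D : R -> R).
  exact: measurable_indic.
apply: (measurableT_comp (@measurable_expR R)).
apply: measurable_funD; apply: measurable_funM => //.
- apply: measurable_funM; first by apply: measurable_funB; exact: mI.
  by apply: measurable_funB => //; apply: measurable_funM => //; exact: mI.
- by apply: measurable_funX; apply: measurable_funB; exact: mI.
Qed.

(** Given the design, the exponent is affine in the noise: [xi i] has coefficient
    [4 * kappa * h (X i)], where [h] is the difference of the indicators of [A] and [B]. The choice
    of [kappa] minimises [- 2 kappa + 8 sigma^2 kappa^2], the exponent reached where [A] and [B]
    differ and [B] agrees with [G]. *)
Lemma contrast_mgf_le n (sigma kappa : R) (X xi : 'I_n -> {RV P >-> R})
    (G A B : set R) :
    kappa = (8 * sigma ^+ 2)^-1 -> 0 < sigma ->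
    measurable G -> measurable A -> measurable B ->
    iid_subgaussian sigma xi -> noise_independent_of_design X xi ->
  (\int[P]_w (expR (2 * kappa * (contrast A (observations X xi G w) -
      contrast B (observations X xi G w))))%:E <=
   \int[P]_w (\prod_(i < n) tilt kappa G A B (X i w))%:E)%E.
Proof.
move=> kappaE s0 mG mA mB [indxi _ subxi] indX.
have mI (D : set R) : measurable D -> measurable_fun [set: R] (\1_D : R -> R).
  exact: measurable_indic.
pose h (x : R) : R := \1_A x - \1_B x.
have mh : measurable_fun setT h by apply: measurable_funB; exact: mI.
pose a (x : R) := expR (2 * kappa * (h x * (2 * \1_G x - 1))).
have ma : measurable_fun setT a.
  apply: (measurableT_comp (@measurable_expR R)).
  apply: measurable_funM => //; apply: measurable_funM => //.
  by apply: measurable_funB => //; apply: measurable_funM => //; exact: mI.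
pose g (x y : R) := a x * expR (4 * kappa * h x * y).
have mV : measurable_fun setT (fun w => [tuple X i w | i < n]).
  apply/measurable_fun_tnthP => i.
  by rewrite (_ : _ \o _ = X i)//; apply/funext => w /=; rewrite tnth_mktuple.
have mW : measurable_fun setT (fun w => [tuple xi i w | i < n]).
  apply/measurable_fun_tnthP => i.
  by rewrite (_ : _ \o _ = xi i)//; apply/funext => w /=; rewrite tnth_mktuple.
pose V : {mfun T >-> n.-tuple R} := mfun_Sub (mem_set mV).
pose W : {mfun T >-> n.-tuple R} := mfun_Sub (mem_set mW).
pose f (z : n.-tuple R * n.-tuple R) : R :=
  \prod_(i < n) g (tnth z.1 i) (tnth z.2 i).
have g0 x y : 0 <= g x y by rewrite mulr_ge0// expR_ge0.
have mf : measurable_fun setT f.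
  apply: measurable_prod => i _.
  have m1 : measurable_fun [set: n.-tuple R * n.-tuple R] (fun z => tnth z.1 i).
    exact: (measurableT_comp (measurable_tnth i) measurable_fst).
  have m2 : measurable_fun [set: n.-tuple R * n.-tuple R] (fun z => tnth z.2 i).
    exact: (measurableT_comp (measurable_tnth i) measurable_snd).
  apply: measurable_funM; first exact: measurableT_comp.
  apply: (measurableT_comp (@measurable_expR R)).
  by apply: measurable_funM => //; apply: measurable_funM => //; exact: measurableT_comp.
have f0 z : 0 <= f z by apply: prodr_ge0.
rewrite (_ : (\int[P]_w _)%E = (\int[P]_w (f (V w, W w))%:E)%E); last first.
  apply: eq_integral => w _; congr EFin.
  rewrite /f (eq_bigr (fun i => expR
    (2 * kappa * (h (X i w) * (2 * (\1_G (X i w) + xi i w) - 1))))); last first.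
    by move=> i _ /=; rewrite !tnth_mktuple /g /a -expRD; congr expR; ring.
  rewrite -expR_sum; congr expR; rewrite /contrast -sumrB big_distrr/=.
  by apply: eq_bigr => i _; rewrite tnth_mktuple /h/=; ring.
rewrite (@independent_pair_integral _ _ _ P _ _ _ _ V W (EFin \o f))//; last first.
  exact/measurable_EFinP.
have mgfE i (t : R) : ('M_P (xi i) t = \int[P]_w (expR (t * xi i w))%:E)%E.
  rewrite /mmt_gen_fun unlock; apply: eq_integral => w _ /=.
  by rewrite mulrC.
have mgf_fin i t : 'M_P (xi i) t \is a fin_num.
  rewrite ge0_fin_numE; first by apply: le_lt_trans (subxi i t) _; rewrite ltry.
  by rewrite mgfE; apply: integral_ge0 => w _; rewrite lee_fin expR_ge0.
have mtilt := measurable_tilt kappa mG mA mB.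
have innerE w : (\int[P]_w' (f (V w, W w'))%:E = (\prod_(i < n)
    (a (X i w) * fine ('M_P (xi i) (4 * kappa * h (X i w)))))%:E)%E.
  rewrite /f; under eq_integral => w' _.
    under eq_bigr => i _ do rewrite /= !tnth_mktuple.
    over.
  apply: (mutually_independent_integral_prod (g := fun i => g (X i w))) => //.
  - move=> i; apply: measurable_funM => //.
    by apply: (measurableT_comp (@measurable_expR R)); apply: measurable_funM.
  - move=> i; rewrite /g EFinM fineK// mgfE -ge0_integralZl//=.
    + apply/measurable_EFinP; apply: (measurableT_comp (@measurable_expR R)).
      exact: measurable_funM.
    + by rewrite lee_fin expR_ge0.
apply: ge0_le_integral => //.
- by move=> w _; apply: integral_ge0 => w' _; rewrite lee_fin.
- apply: (@measurable_integral_comp_pair _ _ _ P _ _ _ _ V W (EFin \o f)).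
    exact/measurable_EFinP.
  by move=> z; rewrite /= lee_fin.
- by apply/measurable_EFinP; apply: measurable_prod => i _; exact: measurableT_comp.
- move=> w _; rewrite innerE lee_fin; apply: ler_prod => i _.
  rewrite mulr_ge0 ?expR_ge0//=; last first.
    by apply: fine_ge0; rewrite mgfE integral_ge0// => ? _; rewrite lee_fin expR_ge0.
  rewrite /tilt expRD ler_wpM2l ?expR_ge0// -lee_fin fineK//.
  apply: (le_trans (subxi i _)); rewrite lee_fin ler_expR.
  (* The last factor is 1 by the choice of [kappa]. *)
  rewrite (_ : _ / 2 = kappa * (h (X i w)) ^+ 2 * (8 * sigma ^+ 2 * kappa)); last by field.
  by rewrite kappaE divff ?mulr1// mulf_neq0// expf_neq0// gt_eqF.
Qed.
End moment_bound.

(** * Products over the design points *)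

Section design_bound.
Context (R : realType) (d : measure_display) (T : measurableType d).
Variable P : probability T R.

(* Being of the form [1 + psi], this majorant of [tilt] is bounded by [exp psi]
   under the deterministic design, and integrates to [1 + E psi] under the
   random one. *)
Definition gap_cells (alpha beta : R) n (s t p q : nat) (x : R) : R :=
  1 - alpha * (s%:R < n%:R * x < t%:R)%R%:R
    + beta * ((p%:R <= n%:R * x < p.+1%:R)%R%:R + (q%:R <= n%:R * x < q.+1%:R)%R%:R).

Definition grid_cell n (m : nat) : set R := `[m%:R / n%:R, m.+1%:R / n%:R[%classic.

Definition grid_gap n (s t : nat) : set R := `]s%:R / n%:R, t%:R / n%:R[%classic.

(** The gap is complemented so that, for [alpha] in [[0, 1]] and [beta >= 0], all coefficients are
    nonnegative and the integral splits termwise. *)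
Lemma gap_cellsE (alpha beta : R) n s t p q x : (0 < n)%N ->
  gap_cells alpha beta n s t p q x =
  (1 - alpha) + alpha * \1_(~` grid_gap n s t) x
    + beta * \1_(grid_cell n p) x + beta * \1_(grid_cell n q) x.
Proof.
move=> n0; have n0' : 0 < n%:R :> R by rewrite ltr0n.
have JE : \1_(~` grid_gap n s t) x = 1 - (s%:R < n%:R * x < t%:R)%R%:R :> R.
  rewrite indicE in_setC /grid_gap set_itvoo.
  rewrite (_ : (x \in _) = (s%:R < n%:R * x < t%:R)).
    by case: (_ < _ < _); rewrite ?subrr ?subr0.
  apply/idP/idP; rewrite inE/= => /andP[].
    by rewrite ltr_pdivrMr// ltr_pdivlMr// mulrC => -> ->.
  by rewrite ltr_pdivrMr// ltr_pdivlMr// (mulrC x) => -> ->.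
have EE m : \1_(grid_cell n m) x = (m%:R <= n%:R * x < m.+1%:R)%R%:R :> R.
  rewrite indicE /grid_cell set_itvco; congr (_%:R); congr nat_of_bool.
  apply/idP/idP; rewrite inE/= => /andP[].
    by rewrite ler_pdivrMr// ltr_pdivlMr// mulrC => -> ->.
  by rewrite ler_pdivrMr// ltr_pdivlMr// (mulrC x) => -> ->.
by rewrite JE !EE /gap_cells; ring.
Qed.

Lemma measurable_gap_cells (alpha beta : R) n s t p q : (0 < n)%N ->
  measurable_fun setT (gap_cells alpha beta n s t p q).
Proof.
move=> n0; rewrite (funext (fun x => gap_cellsE alpha beta s t p q x n0)).
have mI (A : set R) : measurable A -> measurable_fun [set: R] (\1_A : R -> R).
  exact: measurable_indic.
have mkI (k : R) (A : set R) : measurable A ->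
    measurable_fun [set: R] (fun x => k * \1_A x : R).
  by move=> mA; apply: measurable_funM => //; exact: mI.
have mc m : measurable (grid_cell n m) by exact: measurable_itv.
apply: measurable_funD; last exact: mkI.
apply: measurable_funD; last exact: mkI.
apply: measurable_funD => //; apply: mkI; apply: measurableC.
exact: measurable_itv.
Qed.

Lemma deterministic_design_prod_le n (X : 'I_n -> {RV P >-> R}) (f : R -> R)
    (alpha beta : R) (s t p q : nat) w :
    (0 < n)%N -> deterministic_design X -> 0 <= alpha -> 0 <= beta ->
    (t <= n)%N -> (forall x, 0 <= f x <= gap_cells alpha beta n s t p q x) ->
  \prod_(i < n) f (X i w) <= expR (alpha + 2 * beta - alpha * (t - s)%:R).
Proof.
move=> n0 detX a0 b0 tn hf.
have nX i : n%:R * X i w = i.+1%:R.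
  by rewrite detX mulrCA divff ?mulr1// pnatr_eq0 -lt0n.
apply: (@le_trans _ _ (expR (\sum_(i < n)
    (gap_cells alpha beta n s t p q (X i w) - 1)))).
  rewrite expR_sum; apply: ler_prod => i _.
  have /andP[-> hi] := hf (X i w); apply: (le_trans hi).
  by have := expR_ge1Dx (gap_cells alpha beta n s t p q (X i w) - 1); lra.
rewrite ler_expR.
rewrite (eq_bigr (fun i : 'I_n => - alpha * ((s < i.+1 < t)%N : nat)%:R + (beta *
   ((p <= i.+1 < p.+1)%N : nat)%:R + beta * ((q <= i.+1 < q.+1)%N : nat)%:R))); last first.
  by move=> i _; rewrite /gap_cells nX !ltr_nat !ler_nat; ring.
rewrite !big_split/= -!big_distrr/= -!natr_sum sum_grid_interior//.
have hp : (\sum_(i < n) (p <= i.+1 < p.+1)%N)%:R <= 1 :> R by rewrite lern1 sum_grid_cell.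
have hq : (\sum_(i < n) (q <= i.+1 < q.+1)%N)%:R <= 1 :> R by rewrite lern1 sum_grid_cell.
(* An open gap of [t - s] grid steps contains only [t - s - 1] grid points, hence the extra [alpha]
   in the exponent. *)
have hst : (t - s)%:R - 1 <= (t - s.+1)%:R :> R.
  by rewrite lerBlDr natr1 ler_nat; lia.
have := ler_wpM2l a0 hst; have := ler_wpM2l b0 hp; have := ler_wpM2l b0 hq; lra.
Qed.

(** The gap has probability exactly [(t - s) / n]. The integral is presented as a real [c], the form
    taken by the product formula for independent variables. *)
Lemma uniform_integral_gap_cells_le n (U : {RV P >-> R}) (alpha beta : R)
    (s t p q : nat) :
    (0 < n)%N -> 0 <= alpha <= 1 -> 0 <= beta -> (s <= t)%N -> (t <= n)%N ->
    (forall A : set R, measurable A -> P (U @^-1` A) = uniform_prob (@ltr01 R) A) ->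
  exists2 c : R, (\int[P]_w (gap_cells alpha beta n s t p q (U w))%:E = c%:E)%E &
    c <= 1 + (2 * beta - alpha * (t - s)%:R) / n%:R.
Proof.
move=> n0 /andP[a0 a1] b0 st tn unifU.
have n0' : 0 < n%:R :> R by rewrite ltr0n.
pose J := grid_gap n s t.
pose E := grid_cell n.
have mE m : measurable (E m) by exact: measurable_itv.
have mJ : measurable J by exact: measurable_itv.
have mI (A : set R) : measurable A ->
    measurable_fun [set: T] (fun w => (\1_A (U w))%:E : \bar R).
  by move=> mA; apply/measurable_EFinP; apply: measurableT_comp => //; exact: measurable_indic.
have intI (k : R) (A : set R) : 0 <= k -> measurable A ->
    (\int[P]_w (k * \1_A (U w))%:E = k%:E * P (U @^-1` A))%E.
  move=> k0 mA; under eq_integral do rewrite EFinM.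
  rewrite ge0_integralZl//; last exact: mI.
  rewrite -[X in (_ * X)%E]/(\int[P]_w (\1_(U @^-1` A) w)%:E)%E.
  by rewrite integral_indic ?setIT//; exact: measurable_funPTI.
have mkI (k : R) (A : set R) : measurable A ->
    measurable_fun [set: T] (fun w => (k * \1_A (U w))%:E : \bar R).
  move=> mA; under eq_fun do rewrite EFinM; exact: measurable_funeM (mI _ mA).
have k0I (k : R) (A : set R) w : 0 <= k -> (0 <= (k * \1_A (U w))%:E)%E.
  by move=> k0; rewrite lee_fin mulr_ge0.
have a1' : 0 <= 1 - alpha by lra.
have prE A : measurable A -> P (U @^-1` A) = (fine (P (U @^-1` A)))%:E.
  by move=> mA; rewrite fineK// fin_num_measure//; exact: measurable_funPTI.
(* Only an inequality, as a cell may stick out of [[0, 1]]. *)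
have prcell m : fine (P (U @^-1` E m)) <= n%:R^-1.
  rewrite -lee_fin -prE// unifU// uniform_prob01E//.
  apply: (@le_trans _ _ (lebesgue_measure (E m))).
    by apply: measureIl => //; exact: measurable_itv.
  rewrite lebesgue_measure_itv/= lte_fin ltr_pM2r ?invr_gt0// ltr_nat ltnSn.
  by rewrite -EFinD lee_fin -mulrBl -natrB// subSnn mul1r.
have prJ : P (U @^-1` (~` J)) = (1 - (t - s)%:R / n%:R)%:E.
  rewrite unifU; last exact: measurableC.
  rewrite probability_setC// [X in (1 - X)%E](_ : _ = ((t - s)%:R / n%:R)%:E)//.
  transitivity (uniform_prob (@ltr01 R) J) => //.
  rewrite uniform_prob01E// setIidl; last first.
    rewrite /J /grid_gap set_itvoo set_itvcc => x /= /andP[/ltW h1 /ltW h2].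
    rewrite (le_trans _ h1) ?divr_ge0//= (le_trans h2)//.
    by rewrite ler_pdivrMr// mul1r ler_nat.
  rewrite lebesgue_measure_itv/= lte_fin natrB// ltr_pM2r ?invr_gt0// ltr_nat.
  case: ltnP => h; first by rewrite -EFinD mulrBl.
  by rewrite (_ : s = t) ?subrr ?mul0r//; lia.
exists ((1 - alpha) + alpha * (1 - (t - s)%:R / n%:R) +
        beta * fine (P (U @^-1` E p)) + beta * fine (P (U @^-1` E q))).
  transitivity (\int[P]_w (((1 - alpha) * \1_setT (U w))%:E +
      (alpha * \1_(~` J) (U w))%:E + (beta * \1_(E p) (U w))%:E +
      (beta * \1_(E q) (U w))%:E))%E.
    by apply: eq_integral => w _; rewrite gap_cellsE// !EFinD indicT mulr1.
  have mJC : measurable (~` J) by exact: measurableC.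
  have addI (S : T -> \bar R) (k : R) (A : set R) :
      measurable_fun setT S -> (forall w, 0 <= S w)%E -> 0 <= k -> measurable A ->
      (\int[P]_w (S w + (k * \1_A (U w))%:E) =
       \int[P]_w S w + k%:E * P (U @^-1` A))%E.
    move=> mS S0 k0 mA; rewrite ge0_integralD ?intI//.
    - by move=> w _; exact: k0I.
    - exact: mkI.
  have S10 w : (0 <= ((1 - alpha) * \1_setT (U w))%:E)%E by exact: k0I.
  have S20 w := adde_ge0 (S10 w) (k0I alpha (~` J) w a0).
  have S30 w := adde_ge0 (S20 w) (k0I beta (E p) w b0).
  have mS1 := mkI (1 - alpha) setT measurableT.
  have mS2 := emeasurable_funD mS1 (mkI alpha _ mJC).
  have mS3 := emeasurable_funD mS2 (mkI beta _ (mE p)).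
  rewrite (addI _ _ _ mS3 S30 b0 (mE q)) (addI _ _ _ mS2 S20 b0 (mE p)).
  rewrite (addI _ _ _ mS1 S10 a0 mJC) intI//.
  by rewrite preimage_setT probability_setT mule1 prJ [in LHS](prE _ (mE p)) [in LHS](prE _ (mE q)).
have := ler_wpM2l b0 (prcell p); have := ler_wpM2l b0 (prcell q).
rewrite mulrBl -mulrA; lra.
Qed.

(** After passing to the majorant, independence gives a product of [n] integrals, each at most
    [1 + v / n <= exp (v / n)], with [v] the final exponent. *)
Lemma random_design_prod_le n (X : 'I_n -> {RV P >-> R}) (f : R -> R)
    (alpha beta : R) (s t p q : nat) :
    (0 < n)%N -> random_design X -> 0 <= alpha <= 1 -> 0 <= beta ->
    (s <= t)%N -> (t <= n)%N -> measurable_fun setT f ->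
    (forall x, 0 <= f x <= gap_cells alpha beta n s t p q x) ->
  (\int[P]_w (\prod_(i < n) f (X i w))%:E <=
   (expR (2 * beta - alpha * (t - s)%:R))%:E)%E.
Proof.
move=> n0 [U [indU unifU sortU]] a01 b0 st tn mf hf.
have n0' : 0 < n%:R :> R by rewrite ltr0n.
set g := gap_cells alpha beta n s t p q in hf.
have mg : measurable_fun setT g by exact: measurable_gap_cells.
have f0 x : 0 <= f x by have /andP[] := hf x.
have g0 x : 0 <= g x by have /andP[/le_trans h /h] := hf x.
(* The ordering of the design is irrelevant to a symmetric function of it. *)
have XU w : \prod_(i < n) f (X i w) = \prod_(i < n) f (U i w).
  transitivity (\prod_(x <- [seq X i w | i : 'I_n]) f x).
    by rewrite big_image.
  rewrite sortU (perm_big [seq U i w | i : 'I_n]); first by rewrite big_image.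
  by rewrite perm_sort.
have cU i : {c : R | (\int[P]_w (g (U i w))%:E = c%:E)%E &
    c <= 1 + (2 * beta - alpha * (t - s)%:R) / n%:R}.
  by apply: cid2; exact: (uniform_integral_gap_cells_le p q n0 a01 b0 st tn (unifU i)).
pose c i := s2val (cU i).
have cE i : (\int[P]_w (g (U i w))%:E = (c i)%:E)%E by exact: s2valP (cU i).
apply: (@le_trans _ _ (\int[P]_w (\prod_(i < n) g (U i w))%:E)%E).
  apply: ge0_le_integral => //.
  - by move=> w _; rewrite lee_fin; apply: prodr_ge0.
  - apply/measurable_EFinP; apply: measurable_prod => i _; exact: measurableT_comp.
  - apply/measurable_EFinP; apply: measurable_prod => i _; exact: measurableT_comp.
  - by move=> w _; rewrite lee_fin XU; apply: ler_prod.
rewrite (@mutually_independent_integral_prod _ _ _ P _ _ (fun=> g) c)// lee_fin.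
rewrite (_ : 2 * beta - alpha * (t - s)%:R =
  \sum_(i < n) ((2 * beta - alpha * (t - s)%:R) / n%:R)); last first.
  by rewrite sumr_const card_ord -[RHS]mulr_natr mulfVK// gt_eqF.
rewrite expR_sum; apply: ler_prod => i _; apply/andP; split.
  by rewrite -lee_fin -cE; apply: integral_ge0 => w _; rewrite lee_fin.
exact: le_trans (s2valP' (cU i)) (expR_ge1Dx _).
Qed.

Lemma design_prod_le n (X : 'I_n -> {RV P >-> R}) (f : R -> R)
    (alpha beta : R) (s t p q : nat) :
    (0 < n)%N -> deterministic_design X \/ random_design X ->
    0 <= alpha <= 1 -> 0 <= beta ->
    (s <= t)%N -> (t <= n)%N -> measurable_fun setT f ->
    (forall x, 0 <= f x <= gap_cells alpha beta n s t p q x) ->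
  (\int[P]_w (\prod_(i < n) f (X i w))%:E <=
   (expR (alpha + 2 * beta - alpha * (t - s)%:R))%:E)%E.
Proof.
move=> n0 design a01 b0 st tn mf hf; have /andP[a0 a1] := a01.
have f0 x : 0 <= f x by have /andP[] := hf x.
case: design => [detX|ranX].
- apply: (@le_trans _ _ (\int[P]_w (cst (expR
    (alpha + 2 * beta - alpha * (t - s)%:R))%:E w))%E).
    apply: ge0_le_integral => //.
    + by move=> w _; rewrite lee_fin; apply: prodr_ge0.
    + apply/measurable_EFinP; apply: measurable_prod => i _; exact: measurableT_comp.
    + by move=> w _; rewrite lee_fin; apply: deterministic_design_prod_le.
  by rewrite integral_cst// [X in (_ * X)%E](_ : _ = 1%E) ?mule1//; exact: probability_setT.
- apply: le_trans (random_design_prod_le n0 ranX a01 b0 st tn mf hf) _.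
  by rewrite lee_fin ler_expR; lra.
Qed.

(** On the cells of [a] and [b] the crude bound [expR (3 * kappa)] is absorbed by [beta]. Elsewhere
    [[a, b]] and its rounding agree at [x], so the tilt is [expR (- kappa)] or 1 according to
    whether the two grid segments differ at [x]. *)
Lemma tilt_le_gap_cells (kappa a b : R) n (s t p q p0 q0 : nat) x :
    (0 < n)%N -> 0 < kappa ->
    p0%:R <= n%:R * a < p0.+1%:R -> q0%:R <= n%:R * b < q0.+1%:R ->
    (forall y : R, s%:R < y < t%:R ->
       (p%:R <= y <= q%:R) = ~~ (p0%:R <= y <= q0%:R)) ->
  tilt kappa `[a, b]%classic `[p%:R / n%:R, q%:R / n%:R]%classic
    `[p0%:R / n%:R, q0%:R / n%:R]%classic x <=
  gap_cells (1 - expR (- kappa)) (expR (3 * kappa)) n s t p0 q0 x.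
Proof.
move=> n0 k0 /andP[p0a ap0] /andP[q0b bq0] hst.
have n0' : 0 < n%:R :> R by rewrite ltr0n.
have gridE (u v : nat) : \1_(`[u%:R / n%:R, v%:R / n%:R]%classic) x =
    (u%:R <= n%:R * x <= v%:R)%R%:R :> R.
  rewrite indicE set_itvcc; congr (_%:R); congr nat_of_bool.
  apply/idP/idP; rewrite inE/= => /andP[].
    by rewrite ler_pdivrMr// ler_pdivlMr// mulrC => -> ->.
  by rewrite ler_pdivrMr// ler_pdivlMr// (mulrC x) => -> ->.
have GE : \1_(`[a, b]%classic) x = (n%:R * a <= n%:R * x <= n%:R * b)%R%:R :> R.
  rewrite indicE set_itvcc !ler_pM2l//; congr (_%:R); congr nat_of_bool.
  by apply/idP/idP; rewrite inE.
rewrite /tilt /gap_cells !gridE GE.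
move: (n%:R * x) (n%:R * a) (n%:R * b) p0a ap0 q0b bq0 => {gridE GE} y a' b' h1 h2 h3 h4.
have e0 : 0 < expR (- kappa) by exact: expR_gt0.
have e1 : expR (- kappa) <= 1 by rewrite -[leRHS]expR0 ler_expR; lra.
have e3 : 1 <= expR (3 * kappa) by rewrite -[leLHS]expR0 ler_expR; lra.
have := hst y.
(* Here [i] and [j] stand for membership in the selected and the rounded segment, [j] also for
   membership in [[a, b]]; below, [k] is the latter when it may differ. *)
have tiltE (i j : bool) : 2 * kappa * ((i%:R - j%:R) * (2 * j%:R - 1)) +
    kappa * (i%:R - j%:R) ^+ 2 = - kappa * (i (+) j)%:R :> R.
  by case: i j => [] []/=; ring.
have tilt_le (i j k : bool) : 2 * kappa * ((i%:R - j%:R) * (2 * k%:R - 1)) +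
    kappa * (i%:R - j%:R) ^+ 2 <= 3 * kappa :> R.
  by case: i j k => [] [] []/=; lra.
case: (boolP (p0%:R <= y < p0.+1%:R)) => [_|n1].
  move=> _; apply: (@le_trans _ _ (expR (3 * kappa))); first by rewrite ler_expR.
  by case: (_ < _ < _) => /=; case: (_ <= _ < _) => /=; lra.
case: (boolP (q0%:R <= y < q0.+1%:R)) => [_|n2].
  move=> _; apply: (@le_trans _ _ (expR (3 * kappa))); first by rewrite ler_expR.
  by case: (_ < _ < _) => /=; lra.
have -> : (a' <= y <= b') = (p0%:R <= y <= q0%:R).
  apply/idP/idP => /andP[h5 h6].
  - rewrite (le_trans h1 h5)/= leNgt; apply: contra n2 => /ltW ->.
    exact: le_lt_trans h6 h4.
  - rewrite (le_trans h6 h3) andbT leNgt; apply: contra n1 => h7; rewrite h5/=.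
    exact: lt_trans h7 h2.
rewrite tiltE; case: (s%:R < y < t%:R) => [/(_ isT) ->|_].
  by rewrite addNb addbb/= mulr1 !addr0 mulr0; lra.
case: (_ (+) _) => /=; rewrite ?mulr1 ?mulr0 ?expR0; lra.
Qed.

End design_bound.

(** * Risk of the grid estimator and the final bounds *)

Section upper_bound.
Context (R : realType).

(** Half of the exponential rate absorbs the linear weight; the remaining [r ^+ D] factors over the
    two endpoints. *)
Lemma weighted_grid_sum_le (c : R) n p0 q0 : 0 < c ->
  \sum_(k : 'I_n.+1 * 'I_n.+1)
     (((k.1 - p0) + (p0 - k.1) + ((k.2 - q0) + (q0 - k.2)))%:R + 2) *
     expR (- c * ((k.1 - p0) + (p0 - k.1) + ((k.2 - q0) + (q0 - k.2)))%:R) <=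
  2 / c * expR c * (2 / (1 - expR (- (c / 2)))) ^+ 2.
Proof.
move=> c0; set r := expR (- (c / 2)).
have r01 : 0 < r < 1 by rewrite expR_gt0 -[ltRHS]expR0 ltr_expR; lra.
have S0 p : 0 <= \sum_(i < n.+1) r ^+ (i - p + (p - i)).
  by apply: sumr_ge0 => i _; rewrite exprn_ge0// expR_ge0.
apply: (@le_trans _ _ (\sum_(k : 'I_n.+1 * 'I_n.+1) 2 / c * expR c *
    (r ^+ ((k.1 - p0) + (p0 - k.1)) * r ^+ ((k.2 - q0) + (q0 - k.2))))).
  apply: ler_sum => k _; rewrite -exprD; move: (_ + _)%N => D.
  rewrite (_ : r ^+ D = expR (- (c / 2) * D%:R)); last first.
    by rewrite expRM_natr.
  have h : c / 2 * (D%:R + 2) <= expR (c + c / 2 * D%:R).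
    apply: le_trans (expR_ge1Dx _); lra.
  have -> : 2 / c * expR c * expR (- (c / 2) * D%:R) =
      2 / c * expR (c + c / 2 * D%:R) * expR (- c * D%:R).
    by rewrite -!mulrA -!expRD; congr (_ * (_ * expR _)); field.
  rewrite ler_wpM2r ?expR_ge0//.
  rewrite -[leLHS](_ : 2 / c * (c / 2 * (D%:R + 2)) = _).
    by rewrite ler_wpM2l// divr_ge0// ltW.
  by field; rewrite gt_eqF.
rewrite -big_distrr/= ler_wpM2l//.
  by rewrite mulr_ge0 ?expR_ge0// divr_ge0// ltW.
rewrite -(pair_bigA _ (fun i j : 'I_n.+1 => r ^+ ((i - p0) + (p0 - i)) *
  r ^+ ((j - q0) + (q0 - j))))/=.
under eq_bigr do rewrite -big_distrr/=.
rewrite -big_distrl/= expr2; apply: ler_pM => //; exact: geometric_dist_sum.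
Qed.

Context (d : measure_display) (T : measurableType d) (P : probability T R).

Lemma excess_contrast_mgf_le n (sigma mu a b : R) (X xi : 'I_n -> {RV P >-> R})
    (kappa alpha beta : R) (p0 q0 : nat) (k : 'I_n.+1 * 'I_n.+1) :
    kappa = (8 * sigma ^+ 2)^-1 -> alpha = 1 - expR (- kappa) ->
    beta = expR (3 * kappa) ->
    0 < sigma -> 0 < mu -> mu < 1 -> 2 / mu <= n%:R ->
    a <= b -> b <= 1 -> mu <= b - a ->
    p0%:R <= n%:R * a < p0.+1%:R -> q0%:R <= n%:R * b < q0.+1%:R ->
    iid_subgaussian sigma xi -> noise_independent_of_design X xi ->
    deterministic_design X \/ random_design X ->
  (\int[P]_w (expR (2 * kappa *
      (contrast (@grid_segment R n k) (observations X xi `[a, b]%classic w) -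
       contrast `[p0%:R / n%:R, q0%:R / n%:R]%classic
         (observations X xi `[a, b]%classic w))))%:E <=
   (expR (alpha + 2 * beta) * expR (- (alpha * mu / 4) *
     ((k.1 - p0) + (p0 - k.1) + ((k.2 - q0) + (q0 - k.2)))%:R))%:E)%E.
Proof.
move=> kappaE alphaE betaE s0 mu0 mu1 nmu ab b1 muab p0a q0b iid indX design.
have n0' : 0 < n%:R :> R by apply: lt_le_trans nmu; rewrite divr_gt0.
have n0 : (0 < n)%N by rewrite -(ltr0n R).
have kappa0 : 0 < kappa by rewrite kappaE invr_gt0 mulr_gt0// exprn_gt0.
have e0 : 0 < expR (- kappa) by exact: expR_gt0.
have e1 : expR (- kappa) < 1 by rewrite -[ltRHS]expR0 ltr_expR; lra.
have alpha01 : 0 <= alpha <= 1 by rewrite alphaE; lra.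
have beta0 : 0 <= beta by rewrite betaE expR_ge0.
have /andP[h1 h2] := p0a; have /andP[h3 h4] := q0b.
have nb : n%:R * b <= n%:R by rewrite -[leRHS]mulr1 ler_pM2l.
have nab : n%:R * mu <= n%:R * b - n%:R * a by rewrite -mulrBr ler_pM2l.
have nmu2 : 2 <= n%:R * mu by rewrite -ler_pdivrMr.
have pq0 : (p0 <= q0)%N by rewrite -ltnS -(ltr_nat R); lra.
have q0n : (q0 <= n)%N by rewrite -(ler_nat R); lra.
(* Rounding costs less than one grid step, and [n * mu >= 2] makes that at most half of [n * mu]. *)
have len : mu / 2 * n%:R <= (q0 - p0)%:R :> R.
  rewrite natrB//; rewrite -natr1 in h4; lra.
have kn1 : (k.1 <= n)%N by rewrite -ltnS.
have kn2 : (k.2 <= n)%N by rewrite -ltnS.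
have D2n : ((k.1 - p0) + (p0 - k.1) + ((k.2 - q0) + (q0 - k.2)) <= 2 * n)%N.
  move: (nat_of_ord k.1) (nat_of_ord k.2) kn1 kn2 pq0 q0n => p q; clear; lia.
have [s [t [st tn hst hD]]] := @exists_interval_symdiff R n _ _ _ _ kn1 kn2 pq0 q0n.
have mG (u v : R) : measurable `[u, v]%classic by exact: measurable_itv.
apply: le_trans (contrast_mgf_le kappaE s0 (mG _ _) (mG _ _) (mG _ _) iid indX) _.
apply: le_trans (design_prod_le n0 design alpha01 beta0 st tn
  (measurable_tilt _ (mG _ _) (mG _ _) (mG _ _)) _) _.
- move=> x; rewrite {1}/tilt expR_ge0/= alphaE betaE.
  exact: tilt_le_gap_cells p0a q0b hst.
- rewrite lee_fin expRD ler_wpM2l ?expR_ge0// ler_expR.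
  have /andP[alpha0 _] := alpha01.
  rewrite !mulNr lerN2 -!mulrA ler_wpM2l//.
  (* Both alternatives give [t - s >= mu * D / 4]: the first since [mu < 1], the second since
     [t - s >= mu * n / 2] and [D <= 2 * n]. *)
  set D := (_ + _ + _)%N in hD D2n *.
  rewrite -(ler_nat R) natrM in D2n.
  have D0 : 0 <= D%:R :> R by [].
  have mu1' : 0 <= 1 - mu by lra.
  have := mulr_ge0 mu1' D0; have := ler_wpM2l (ltW mu0) D2n.
  by case: hD; rewrite -(ler_nat R) ?natrM; lra.
Qed.

Lemma minimax_upper_bound n (sigma mu : R) (X xi : 'I_n -> {RV P >-> R})
    (kappa alpha beta c : R) :
    kappa = (8 * sigma ^+ 2)^-1 -> alpha = 1 - expR (- kappa) ->
    beta = expR (3 * kappa) -> c = alpha * mu / 4 -> 0 < c ->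
    0 < sigma -> 0 < mu -> mu < 1 -> 2 / mu <= n%:R ->
    iid_subgaussian sigma xi -> noise_independent_of_design X xi ->
    deterministic_design X \/ random_design X ->
  (minimax_risk X xi (segments mu) <=
   (expR (alpha + 2 * beta) *
     (2 / c * expR c * (2 / (1 - expR (- (c / 2)))) ^+ 2) / n%:R)%:E)%E.
Proof.
move=> kappaE alphaE betaE cE c0 s0 mu0 mu1 nmu iid indX design.
have n0' : 0 < n%:R :> R by apply: lt_le_trans nmu; rewrite divr_gt0.
have kappa0 : 0 < kappa by rewrite kappaE invr_gt0 mulr_gt0// exprn_gt0.
have [Gh [m [hm Ghm]]] := grid_estimator R n.
apply: (@le_trans _ _ (risk X xi Gh (segments mu))).
  by apply: ereal_inf_lbound; exists Gh.
apply: ge_ereal_sup => _ [_ [a [b [a0 ab b1 muab ->]]] <-].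
have b0 : 0 <= b by exact: le_trans ab.
pose p0 := Num.truncn (n%:R * a); pose q0 := Num.truncn (n%:R * b).
have p0a : p0%:R <= n%:R * a < p0.+1%:R by apply: truncn_itv; rewrite mulr_ge0.
have q0b : q0%:R <= n%:R * b < q0.+1%:R by apply: truncn_itv; rewrite mulr_ge0.
have bound : forall x : R, 0 <= x <= 1 -> (Num.truncn (n%:R * x) < n.+1)%N.
  move=> x /andP[x0 x1]; rewrite ltnS -(ler_nat R).
  have /andP[h _] := truncn_itv (mulr_ge0 (ltW n0') x0).
  by apply: (le_trans h); rewrite -[leRHS]mulr1 ler_pM2l.
have a01 : 0 <= a <= 1 by rewrite a0 (le_trans ab).
have b01 : 0 <= b <= 1 by rewrite b0.
pose k0 : 'I_n.+1 * 'I_n.+1 := (Ordinal (bound a a01), Ordinal (bound b b01)).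
pose D (k : 'I_n.+1 * 'I_n.+1) : nat :=
  ((k.1 - p0) + (p0 - k.1) + ((k.2 - q0) + (q0 - k.2)))%N.
(* Rounding adds at most one grid step per endpoint, which yields the [+ 2] in the weights. *)
have distE (x : R) (i j : nat) : j%:R <= n%:R * x < j.+1%:R ->
    `|x - i%:R / n%:R| <= (((i - j) + (j - i))%:R + 1) / n%:R.
  move=> /andP[h1 h2]; rewrite ler_pdivlMr// -[X in _ * X]gtr0_norm// -normrM.
  rewrite mulrBl divfK ?gt_eqF// ler_norml (mulrC x).
  rewrite -natr1 in h2.
  case: (leqP i j) => ij.
    rewrite (eqP ij : (i - j = 0)%N) add0n natrB//.
    by apply/andP; split; have : i%:R <= j%:R :> R by [rewrite ler_nat]; lra.
  rewrite (eqP (ltnW ij) : (j - i = 0)%N) addn0 natrB//; last exact: ltnW.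
  by apply/andP; split; have : j%:R < i%:R :> R by [rewrite ltr_nat]; lra.
set obs := observations X xi `[a, b]%classic.
have mobs : measurable_fun setT obs.
  by apply: measurable_observations; exact: measurable_itv.
pose F (k : 'I_n.+1 * 'I_n.+1) (w : T) : R := expR (2 * kappa *
  (contrast (@grid_segment R n k) (obs w) - contrast (@grid_segment R n k0) (obs w))).
have mF k : measurable_fun setT (fun w => (F k w)%:E : \bar R).
  have mc k' : measurable_fun setT (fun w => contrast (@grid_segment R n k') (obs w)).
    apply: measurableT_comp => //; apply: measurable_contrast; exact: measurable_itv.
  apply/measurable_EFinP; apply: (measurableT_comp (@measurable_expR R)).
  by apply: measurable_funM => //; exact: measurable_funB.
have w0 k : 0 <= ((D k)%:R + 2) / n%:R :> R by rewrite divr_ge0// addr_ge0.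
apply: (@le_trans _ _ (\int[P]_w
    (\sum_(k : 'I_n.+1 * 'I_n.+1) (((D k)%:R + 2) / n%:R)%:E * (F k w)%:E))%E).
  apply: ge0_le_integral => //.
  - by apply: measurable_loss; exact: measurable_itv.
  - by apply: emeasurable_sum => k; exact: measurable_funeM.
  - move=> w _; rewrite -/(obs w) Ghm.
    apply: (le_trans (symdiff_itv_measure_le _ _ _ _)).
    set k := m (obs w).
    under eq_bigr do rewrite -EFinM.
    (* Only the term of the selected index is kept; its exponential is at least 1 because [k]
       maximises the contrast and [k0] is a competitor. *)
    rewrite sumEFin lee_fin (bigD1 k)//=.
    apply: ler_wpDr.
      by apply: sumr_ge0 => j _; rewrite mulr_ge0// expR_ge0.
    apply: (@le_trans _ _ (((D k)%:R + 2) / n%:R)).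
      apply: (le_trans (lerD (distE _ _ _ p0a) (distE _ _ _ q0b))).
      by rewrite -mulrDl ler_pM2r ?invr_gt0// /D [in leRHS]natrD; lra.
    rewrite ler_peMr// -[leLHS]expR0 ler_expR mulr_ge0 ?subr_ge0//.
    by rewrite mulr_ge0// ltW.
rewrite ge0_integral_sum//; last 2 first.
- by move=> k; exact: measurable_funeM.
- by move=> k w _; rewrite mule_ge0// lee_fin// expR_ge0.
set K := expR (alpha + 2 * beta).
apply: (@le_trans _ _ (\sum_(k : 'I_n.+1 * 'I_n.+1)
    (((D k)%:R + 2) / n%:R * (K * expR (- c * (D k)%:R)))%:E)%E).
  apply: lee_sum => k _.
  rewrite ge0_integralZl//; last first.
    by move=> w _; rewrite lee_fin expR_ge0.
  rewrite [leRHS]EFinM; apply: lee_wpmul2l; rewrite ?lee_fin// cE.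
  exact: (excess_contrast_mgf_le _ kappaE alphaE betaE s0 mu0 mu1 nmu ab b1 muab p0a q0b).
rewrite sumEFin lee_fin.
rewrite (eq_bigr (fun k => K / n%:R * (((D k)%:R + 2) * expR (- c * (D k)%:R)))); last first.
  by move=> k _; field; rewrite gt_eqF.
rewrite -big_distrr/= [leRHS]mulrAC; apply: ler_wpM2l.
  by rewrite divr_ge0 ?expR_ge0// ltW.
exact: weighted_grid_sum_le.
Qed.

End upper_bound.

Theorem theorem11 (R : realType) (mu sigma : R)
    (mu_gt0 : 0 < mu) (mu_lt1 : mu < 1) (sigma_gt0 : 0 < sigma) :
  exists (c C : R) (n0 : nat), [/\ 0 < c, 0 < C &
    forall (n : nat), (n0 <= n)%N ->
    forall (d : measure_display) (T : measurableType d) (P : probability T R)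
      (X xi : 'I_n -> {RV P >-> R}),
      iid_subgaussian sigma xi ->
      noise_independent_of_design X xi ->
      deterministic_design X \/ random_design X ->
      ((c / n%:R)%:E <= minimax_risk X xi (segments mu))%E /\
      (minimax_risk X xi (segments mu) <= (C / n%:R)%:E)%E].
Proof.
pose kappa := (8 * sigma ^+ 2)^-1.
pose alpha := 1 - expR (- kappa).
pose c := alpha * mu / 4.
have kappa0 : 0 < kappa by rewrite invr_gt0 mulr_gt0// exprn_gt0.
have alpha0 : 0 < alpha by rewrite subr_gt0 -[ltRHS]expR0 ltr_expR; lra.
have c0 : 0 < c by rewrite divr_gt0// mulr_gt0.
have r1 : 0 < 1 - expR (- (c / 2)).
  by rewrite subr_gt0 -[ltRHS]expR0 ltr_expR; lra.
(* The first term gives [n * mu >= 2] for the upper bound; the second gives [mu <= 1 - 1/n], which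
   puts both segments of the two-point argument in the class. *)
pose n0 := maxn (Num.truncn (2 / mu)).+1 (Num.truncn (1 - mu)^-1).+1.
exists 8^-1, (expR (alpha + 2 * expR (3 * kappa)) *
  (2 / c * expR c * (2 / (1 - expR (- (c / 2)))) ^+ 2)), n0.
split; [by rewrite invr_gt0| |].
  rewrite mulr_gt0 ?expR_gt0//; apply: mulr_gt0; last first.
    by rewrite exprn_gt0// divr_gt0.
  by rewrite mulr_gt0 ?expR_gt0// divr_gt0.
move=> n n0n d T P X xi iid indX design.
have truncn_le (x : R) : 0 <= x -> ((Num.truncn x).+1 <= n)%N -> x <= n%:R.
  move=> x0 h; have /andP[_ /ltW/le_trans] := truncn_itv x0; apply.
  by rewrite ler_nat.
have [h1 h2] : ((Num.truncn (2 / mu)).+1 <= n)%N /\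
    ((Num.truncn (1 - mu)^-1).+1 <= n)%N by move: n0n; rewrite /n0; lia.
have mu1 : 0 < 1 - mu by rewrite subr_gt0.
have nmu : 2 / mu <= n%:R by apply: truncn_le => //; rewrite divr_ge0// ltW.
have nmu' : (1 - mu)^-1 <= n%:R by apply: truncn_le => //; rewrite invr_ge0 ltW.
have n_gt0 : (0 < n)%N by lia.
split; last exact: (minimax_upper_bound _ _ _ _ c0).
apply: minimax_lower_bound => //.
have := nmu'; rewrite -lef_pV2 ?invrK ?posrE ?ltr0n ?invr_gt0//; lra.
Qed.
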